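(* Assume that $L\subset\mathbb{R}^n$ is an $(n-1)$-dimensional (affine) hyperplane whose normal is not contained in $(-\infty,0]^n\cup[0,\infty)^n$. Then $\mu(L)=0$ for all Nevanlinna measures $\mu$ on $\mathbb{R}^n$.
   Context: A positive Borel measure $\mu$ on $\mathbb{R}^n$ is called a Nevanlinna measure if it satisfies the growth condition $\int_{\mathbb{R}^n}\prod_{\ell=1}^n\frac{1}{1+t_\ell^2}\,d\mu(t)<\infty$ and the Nevanlinna condition $$\int_{\mathbb{R}^n}\frac{1}{(t_{j_1}-z_{j_1})^2(t_{j_2}-\overline{z_{j_2}})^2}\prod_{\ell\ne j_1,j_2}\Big(\frac{1}{t_\ell-z_\ell}-\frac{1}{t_\ell-\overline{z_\ell}}\Big)d\mu(t)=0$$ for all $z\in(\mathbb{C}^+)^n$ and all indices $1\le j_1<j_2\le n$, where $\mathbb{C}^+=\{z\in\mathbb{C}:\operatorname{Im} z>0\}$. *)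

(* Defs.v *)
From HB Require Import structures.
From mathcomp Require Import all_boot all_order all_algebra.
From mathcomp Require Import complex.
From mathcomp Require Import all_classical all_reals all_analysis.

Set Implicit Arguments.
Unset Strict Implicit.
Unset Printing Implicit Defensive.

Import Order.TTheory GRing.Theory Num.Theory.
Import numFieldNormedType.Exports.

Local Open Scope classical_set_scope.
Local Open Scope ring_scope.
Local Open Scope complex_scope.

(* [borel_rV R n] is the type 'rV[R]_n itself, equipped with the sigma-algebra
   generated by the open sets of the product topology. *)
Notation borel_rV R n := (g_sigma_algebraType (@open 'rV[R]_n)).

(* MathComp-Analysis only integrates real-valued functions; this is meaningful
   when the real and imaginary parts of [f] are integrable. *)
Definition cintegral (d : measure_display) (T : measurableType d)
    (R : realType) (mu : {measure set T -> \bar R}) (f : T -> R[i]) : R[i] :=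
  (\int[mu]_t complex.Re (f t)) +i* (\int[mu]_t complex.Im (f t)).

Section Nevanlinna.
Variables (R : realType) (n : nat).

Definition poly_upper_half_plane : set 'rV[R[i]]_n :=
  [set z : 'rV[R[i]]_n | forall l, 0 < complex.Im (z 0 l)].

Definition growth_condition (mu : {measure set (borel_rV R n) -> \bar R}) :
    Prop :=
  (\int[mu]_t (\prod_(l < n) (1 + (t : 'rV[R]_n) 0 l ^+ 2)^-1)%:E < +oo)%E.

Definition nevanlinna_kernel (z : 'rV[R[i]]_n) (j1 j2 : 'I_n) (t : 'rV[R]_n) :
    R[i] :=
  1 / (((t 0 j1)%:C - z 0 j1) ^+ 2 * ((t 0 j2)%:C - conjc (z 0 j2)) ^+ 2) *
  \prod_(l < n | (l != j1) && (l != j2))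
     (1 / ((t 0 l)%:C - z 0 l) - 1 / ((t 0 l)%:C - conjc (z 0 l))).

(* Under the growth condition the kernel is integrable for every [z] in the
   poly-upper half-plane, so the integral below is never a default value. *)
Definition nevanlinna_condition
    (mu : {measure set (borel_rV R n) -> \bar R}) : Prop :=
  forall (z : 'rV[R[i]]_n) (j1 j2 : 'I_n),
    poly_upper_half_plane z -> (j1 < j2)%N ->
    cintegral mu (nevanlinna_kernel z j1 j2) = 0.

Definition nevanlinna_measure
    (mu : {measure set (borel_rV R n) -> \bar R}) : Prop :=
  growth_condition mu /\ nevanlinna_condition mu.

Definition is_hyperplane_with_normal (L : set 'rV[R]_n) (a : 'rV[R]_n) :
    Prop :=
  a != 0 /\
  exists c : R, L = [set x : 'rV[R]_n | \sum_(i < n) a 0 i * x 0 i = c].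

Definition nonpos_orthant : set 'rV[R]_n :=
  [set a : 'rV[R]_n | forall i, a 0 i <= 0].

Definition nonneg_orthant : set 'rV[R]_n :=
  [set a : 'rV[R]_n | forall i, 0 <= a 0 i].

End Nevanlinna.

Arguments nonpos_orthant : clear implicits.
Arguments nonneg_orthant : clear implicits.

(* Main.v *)
Require Import Defs.
From mathcomp Require Import all_boot all_order all_algebra.
From mathcomp Require Import complex ring lra.
From mathcomp Require Import all_classical all_reals all_analysis.
From mathcomp Require Import measurable_realfun.

Set Implicit Arguments.
Unset Strict Implicit.
Unset Printing Implicit Defensive.

Import Order.TTheory GRing.Theory Num.Theory.
Import numFieldNormedType.Exports.

Local Open Scope classical_set_scope.
Local Open Scope ring_scope.

(** Write the hyperplane, up to permutation of the two roles, as a graph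
    t_1 = b_2 t_2 + sum_l b_l t_l + c over the other coordinates, where
    coordinates 1 and 2 are two directions in which the normal has opposite
    signs; the sign condition says exactly b_2 > 0.  For z = x + i w the
    Nevanlinna kernel at t is, up to a constant factor,
      1 / ((s_1 - i w_1)^2 (s_2 + i w_2)^2) * prod_l w_l^2 / (s_l^2 + w_l^2)
    with s = t - x.  Hence its normalised real part, [profile], has integral
    zero for every centre x and all widths w ([profile_integral0]).

    In two variables, choose x on the line and w_1 = b_2 w_2.  For t on the
    line s_1 = b_2 s_2, so s_1 - i w_1 is a positive multiple of the conjugate
    of s_2 + i w_2 and the profile is positive on the line.  Sum these profiles
    over centres x spaced at distance w_2 along a segment of the line.  The sum
    is bounded below on the segment, tends to zero off the line as w_2 tends to
    zero, and is dominated by a multiple of the growth weight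
    prod_l 1 / (1 + t_l^2).  Its integral is zero, so in the limit the segment
    has measure zero.  With a normal of constant sign the
    profile would change sign on the line.

    In higher dimension the centres run over a grid of the hyperplane,
    parametrised by all coordinates but the first.  Moving in the remaining
    directions breaks the relation s_1 = b_2 s_2, so their widths are taken much
    smaller: w_2 = 1/N and w_l = 1/N^3.  Centres with s_l at most a small
    multiple of 1/N in these directions still contribute nonnegatively
    ([near_profile]); the other centres contribute O(1/N) in total
    ([far_mass_small]), because a Lorentz factor with width w is at most w^2 / d^2 at
    distance d, and the grid has only O(1/w) steps in that direction.  The same
    count shows that the sum tends to zero off the hyperplane, where every
    centre is far.  The sums of Lorentz factors along one grid direction are
    bounded uniformly in N ([sum_lorentz_grid]), which gives the domination
    ([grid_sum_growth]), and Fatou's lemma concludes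
    ([vanishing_integrals_null]). *)

(** * Lorentz factors and the real form of the kernel *)

(** The Poisson kernel of the upper half-plane at height [w], normalised to have
    maximum 1. *)
Definition lorentz (R : realType) (w s : R) : R := w ^+ 2 / (s ^+ 2 + w ^+ 2).

Section Profile.
Variables (R : realType) (n : nat) (j1 j2 : 'I_n).
Implicit Types (w s : 'I_n -> R).

(** [reX + i imX] is the product (s_1 - i w_1) (s_2 + i w_2). *)
Definition reX w s : R := s j1 * s j2 + w j1 * w j2.
Definition imX w s : R := s j1 * w j2 - w j1 * s j2.

Definition other_lorentz w s : R :=
  \prod_(l | (l != j1) && (l != j2)) lorentz (w l) (s l).

(** [profile + i coprofile] is (w_1 w_2)^2 / (reX + i imX)^2 times the Lorentz
    factors in the other directions, that is, the Nevanlinna kernel divided by a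
    constant.  The normalisation makes the product of all the Lorentz factors a
    bound for both parts. *)
Definition profile w s : R :=
  (w j1 * w j2) ^+ 2 * (reX w s ^+ 2 - imX w s ^+ 2)
    / (reX w s ^+ 2 + imX w s ^+ 2) ^+ 2 * other_lorentz w s.

Definition coprofile w s : R :=
  (w j1 * w j2) ^+ 2 * (- 2 * (reX w s * imX w s))
    / (reX w s ^+ 2 + imX w s ^+ 2) ^+ 2 * other_lorentz w s.

Lemma reXimX w s :
  reX w s ^+ 2 + imX w s ^+ 2
  = (s j1 ^+ 2 + w j1 ^+ 2) * (s j2 ^+ 2 + w j2 ^+ 2).
Proof. by rewrite /reX /imX; ring. Qed.

Lemma sqD_gt0 (a b : R) : 0 < b -> 0 < a ^+ 2 + b ^+ 2.
Proof. by move=> b0; rewrite ltr_wpDl ?sqr_ge0 ?exprn_gt0. Qed.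

Lemma inv_conj_square (s1 s2 w1 w2 : R) (X := s1 * s2 + w1 * w2)
    (Y := s1 * w2 - w1 * s2) : 0 < w1 -> 0 < w2 ->
  1 / (((s1 -i* w1)%C) ^+ 2 * ((s2 +i* w2)%C) ^+ 2)
  = (((X ^+ 2 - Y ^+ 2) / (X ^+ 2 + Y ^+ 2) ^+ 2)
      +i* (- 2 * (X * Y) / (X ^+ 2 + Y ^+ 2) ^+ 2))%C.
Proof.
move=> w10 w20.
have XY : X ^+ 2 + Y ^+ 2 != 0.
  rewrite (_ : _ + _ = (s1 ^+ 2 + w1 ^+ 2) * (s2 ^+ 2 + w2 ^+ 2)).
    by rewrite mulf_neq0// gt_eqF// sqD_gt0.
  by rewrite /X /Y; ring.
have key : ((s1 -i* w1)%C) * ((s2 +i* w2)%C) = (X +i* Y)%C.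
  by apply/eqP; rewrite eq_complex /X /Y /=; apply/andP; split; apply/eqP; ring.
rewrite -exprMn key.
apply: (@mulIf _ ((X +i* Y)%C ^+ 2)).
  rewrite expf_neq0//; apply/negP => /eqP[X0 Y0].
  by move: XY; rewrite X0 Y0 expr0n addr0 eqxx.
rewrite mul1r mulVf; last first.
  rewrite expf_neq0//; apply/negP => /eqP[X0 Y0].
  by move: XY; rewrite X0 Y0 expr0n addr0 eqxx.
rewrite expr2.
apply/eqP; rewrite eq_complex /=; apply/andP; split; apply/eqP; field => //.
Qed.

(** Each factor is purely imaginary with constant argument, so the product
    contributes a constant phase and a positive real function. *)
Lemma poisson_factor (t x w : R) : 0 < w ->
  1 / ((t%:C)%C - (x +i* w)%C) - 1 / ((t%:C)%C - conjc (x +i* w)%C)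
  = (0 +i* (2 / w))%C * ((lorentz w (t - x))%:C)%C.
Proof.
move=> w0; rewrite /lorentz.
have h0 : (t - x) ^+ 2 + w ^+ 2 != 0 by rewrite gt_eqF// sqD_gt0.
have wn0 : w != 0 by rewrite gt_eqF.
rewrite /= !mul1r.
have -> : (t%:C)%C - (x +i* w)%C = ((t - x) -i* w)%C.
  by apply/eqP; rewrite eq_complex /= sub0r !eqxx.
have -> : (t%:C)%C - (x -i* w)%C = ((t - x) +i* w)%C.
  by apply/eqP; rewrite eq_complex /= sub0r opprK !eqxx.
apply/eqP; rewrite eq_complex /=; apply/andP; split; apply/eqP; field;
 rewrite ?wn0 ?h0 //=.
Qed.

Definition kernel_const w : R[i] :=
  ((((w j1 * w j2) ^- 2)%:C)%C *
   \prod_(l | (l != j1) && (l != j2)) ((0 +i* (2 / w l))%C : R[i])).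

Lemma kernel_const_neq0 w : (forall l, 0 < w l) -> kernel_const w != 0.
Proof.
move=> w0; rewrite mulf_neq0//.
  rewrite eq_complex /= negb_and.
  by rewrite invr_eq0 expf_eq0/= mulf_eq0 (gt_eqF (w0 j1)) (gt_eqF (w0 j2)).
apply/prodf_neq0 => l _.
by rewrite eq_complex /= eqxx mulf_eq0 invr_eq0 pnatr_eq0 (gt_eqF (w0 l)).
Qed.

Lemma nevanlinna_kernelE w (x : 'I_n -> R) (t : 'rV[R]_n) :
  (forall l, 0 < w l) ->
  nevanlinna_kernel (\row_l ((x l) +i* (w l))%C) j1 j2 t
  = kernel_const w * ((profile w (fun l => t 0 l - x l))
                      +i* (coprofile w (fun l => t 0 l - x l)))%C.
Proof.
move=> w0; rewrite /nevanlinna_kernel.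
under eq_bigr => l _ do rewrite mxE poisson_factor//.
rewrite big_split/= -(rmorph_prod (real_complex R)) !mxE.
have -> : ((t 0 j1)%:C)%C - ((x j1) +i* (w j1))%C
   = ((t 0 j1 - x j1) -i* w j1)%C.
  by apply/eqP; rewrite eq_complex /= sub0r !eqxx.
have -> : ((t 0 j2)%:C)%C - conjc ((x j2) +i* (w j2))%C
    = ((t 0 j2 - x j2) +i* w j2)%C.
  by apply/eqP; rewrite eq_complex /= sub0r opprK !eqxx.
have an0 : w j1 * w j2 != 0 by rewrite mulf_neq0// gt_eqF.
have -> : (profile w (fun l => t 0 l - x l)
           +i* coprofile w (fun l => t 0 l - x l))%C
    = (((w j1 * w j2) ^+ 2)%:C)%C
      * (1 / (((t 0 j1 - x j1) -i* w j1)%C ^+ 2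
             * ((t 0 j2 - x j2) +i* w j2)%C ^+ 2))
      * ((other_lorentz w (fun l => t 0 l - x l))%:C)%C.
  rewrite inv_conj_square//; apply/eqP.
  by rewrite eq_complex /profile /coprofile /reX /imX /=;
     apply/andP; split; apply/eqP; ring.
rewrite /kernel_const fmorphV.
have : (((w j1 * w j2) ^+ 2)%:C)%C != 0 :> R[i].
  by rewrite fmorph_eq0 expf_neq0.
rewrite /= -/(other_lorentz w (fun l => t 0 l - x l)).
move: (other_lorentz _ _) => p.
move: (\prod_(_ | _) _) (1 / _) => P E.
move: (((w j1 * w j2) ^+ 2)%:C)%C (p%:C)%C => A q A0.
by field.
Qed.

Lemma lorentz_ge0 (w s : R) : 0 <= lorentz w s.
Proof. by rewrite divr_ge0 ?addr_ge0 ?sqr_ge0. Qed.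

Lemma prod_lorentzE w s : j1 != j2 ->
  \prod_l lorentz (w l) (s l)
  = lorentz (w j1) (s j1) * lorentz (w j2) (s j2) * other_lorentz w s.
Proof.
move=> j12; rewrite (bigD1 j1)//= (bigD1 j2)/= 1?eq_sym// mulrA.
by congr (_ * _); apply: eq_bigl => l; rewrite andbC.
Qed.

(** Applied with [Y] the squared modulus of [reX + i imX] and [X] the real or
    imaginary part of its squared conjugate. *)
Lemma le_scaled_ratio (A X Y L1 p : R) : 0 <= A -> 0 <= p ->
  `|X| <= Y -> 0 < Y -> A / Y = L1 -> `|A * X / Y ^+ 2 * p| <= L1 * p.
Proof.
move=> A0 p0 XY Y0 <-.
rewrite normrM (ger0_norm p0) ler_wpM2r// !normrM (ger0_norm A0).
rewrite (ger0_norm (_ : 0 <= (Y ^+ 2)^-1)) ?invr_ge0 ?sqr_ge0//.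
rewrite -mulrA ler_wpM2l// ler_pdivrMr ?exprn_gt0//.
by rewrite expr2 mulrA mulVf ?gt_eqF// mul1r.
Qed.

Lemma profile_le w s : j1 != j2 -> (forall l, 0 < w l) ->
  `|profile w s| <= \prod_l lorentz (w l) (s l).
Proof.
move=> j12 w0; rewrite prod_lorentzE//.
apply: le_scaled_ratio => //.
- by rewrite sqr_ge0.
- by apply: prodr_ge0 => *; exact: lorentz_ge0.
- by rewrite ler_norml; apply/andP; split;
    have := sqr_ge0 (reX w s); have := sqr_ge0 (imX w s); lra.
- by rewrite reXimX mulr_gt0// sqD_gt0.
- by rewrite reXimX /lorentz; field; rewrite !gt_eqF ?sqD_gt0.
Qed.

Lemma coprofile_le w s : j1 != j2 -> (forall l, 0 < w l) ->
  `|coprofile w s| <= \prod_l lorentz (w l) (s l).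
Proof.
move=> j12 w0; rewrite prod_lorentzE//.
apply: le_scaled_ratio => //.
- by rewrite sqr_ge0.
- by apply: prodr_ge0 => *; exact: lorentz_ge0.
- rewrite ler_norml; apply/andP; split.
    by have := sqr_ge0 (reX w s - imX w s); rewrite sqrrB; lra.
  by have := sqr_ge0 (reX w s + imX w s); rewrite sqrrD; lra.
- by rewrite reXimX mulr_gt0// sqD_gt0.
- by rewrite reXimX /lorentz; field; rewrite !gt_eqF ?sqD_gt0.
Qed.
End Profile.

Lemma growth_shift (R : realType) (t x : R) :
  1 + t ^+ 2 <= 2 * (1 + x ^+ 2) * (1 + (t - x) ^+ 2).
Proof.
have := sqr_ge0 (t - 2 * x); have := sqr_ge0 ((t - x) * x).
by rewrite exprMn !expr2; lra.
Qed.

Lemma lorentz_growth (R : realType) (w x t : R) : 0 < w ->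
  lorentz w (t - x) <= 2 * (1 + w ^+ 2) * (1 + x ^+ 2) * (1 + t ^+ 2)^-1.
Proof.
move=> w0.
have p1 (u : R) : 0 < 1 + u ^+ 2 by rewrite ltr_pwDl// sqr_ge0.
apply: (@le_trans _ _ ((1 + w ^+ 2) / (1 + (t - x) ^+ 2))).
  rewrite ler_pdivrMr ?sqD_gt0// mulrAC ler_pdivlMr//.
  move: (sqr_ge0 (t - x)) (sqr_ge0 w).
  set s := (t - x) ^+ 2; set v := w ^+ 2 => s0 v0.
  by have := mulr_ge0 s0 v0; have := mulr_ge0 v0 v0; lra.
rewrite ler_pdivrMr// mulrAC ler_pdivlMr//.
have := ler_wpM2l (ltW (p1 w)) (growth_shift t x).
by lra.
Qed.

(** * The integral of a profile *)

Section Integral.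
Variables (R : realType) (n : nat).
Local Notation T := (borel_rV R n).

Lemma continuous_borel_measurable (f : 'rV[R]_n -> R) :
  continuous f -> measurable_fun [set: T] (f : T -> R).
Proof.
move=> /continuousP cf.
apply: (measurability _ (measurable_realfun.RGenOpens.measurableE R)).
move=> _ [_ [a [b ->] <-]]; rewrite setTI; apply: sub_sigma_algebra.
exact/cf/interval_open.
Qed.

Lemma measurable_shift_coord (x : R) (l : 'I_n) :
  measurable_fun [set: T] (fun t : T => (t : 'rV[R]_n) 0 l - x).
Proof.
by apply: measurable_funB => //; apply: continuous_borel_measurable;
   exact: coord_continuous.
Qed.

Lemma measurable_inv_nonneg (d : measure_display) (S : measurableType d)
    (f : S -> R) : (forall t, 0 <= f t) -> measurable_fun [set: S] f ->
  measurable_fun [set: S] (fun t => (f t)^-1).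
Proof.
move=> f0 mf; under eq_fun => t do rewrite -powR_inv1//.
exact: (measurableT_comp (measurable_powR (-1)) mf).
Qed.

Section ProfileIntegral.
Variables (j1 j2 : 'I_n) (w x : 'I_n -> R).

Definition growth_weight (t : 'rV[R]_n) : R := \prod_l (1 + t 0 l ^+ 2)^-1.

Lemma measurable_lorentz l :
  measurable_fun [set: T] (fun t : T => lorentz (w l) ((t : 'rV[R]_n) 0 l - x l)).
Proof.
apply: measurable_funM => //; apply: measurable_inv_nonneg => [t|].
  by rewrite addr_ge0 ?sqr_ge0.
by apply: measurable_funD => //; apply: measurable_funX; exact: measurable_shift_coord.
Qed.

Lemma measurable_other_lorentz :
  measurable_fun [set: T]
    (fun t : T => other_lorentz j1 j2 w (fun l => (t : 'rV[R]_n) 0 l - x l)).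
Proof.
have -> : (fun t : T => other_lorentz j1 j2 w (fun l => (t : 'rV[R]_n) 0 l - x l))
  = fun t : T => \prod_l (if (l != j1) && (l != j2)
      then lorentz (w l) ((t : 'rV[R]_n) 0 l - x l) else 1).
  by apply/funext => t; rewrite /other_lorentz big_mkcond.
apply: measurable_prod => l _; case: (_ && _); first exact: measurable_lorentz.
exact: measurable_cst.
Qed.

Lemma measurable_reX :
  measurable_fun [set: T]
    (fun t : T => reX j1 j2 w (fun l => (t : 'rV[R]_n) 0 l - x l)).
Proof.
by apply: measurable_funD => //; apply: measurable_funM;
  exact: measurable_shift_coord.
Qed.

Lemma measurable_imX :
  measurable_fun [set: T]
    (fun t : T => imX j1 j2 w (fun l => (t : 'rV[R]_n) 0 l - x l)).
Proof.
by apply: measurable_funB => //; apply: measurable_funM => //;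
  exact: measurable_shift_coord.
Qed.

Lemma measurable_profile :
  measurable_fun [set: T]
    (fun t : T => profile j1 j2 w (fun l => (t : 'rV[R]_n) 0 l - x l)).
Proof.
have mX := measurable_reX; have mY := measurable_imX.
apply: measurable_funM measurable_other_lorentz.
apply: measurable_funM.
  by apply: measurable_funM => //; apply: measurable_funB; exact: measurable_funX.
apply: measurable_inv_nonneg => [t|]; first exact: sqr_ge0.
by apply: measurable_funX; apply: measurable_funD; exact: measurable_funX.
Qed.

Lemma measurable_coprofile :
  measurable_fun [set: T]
    (fun t : T => coprofile j1 j2 w (fun l => (t : 'rV[R]_n) 0 l - x l)).
Proof.
have mX := measurable_reX; have mY := measurable_imX.
apply: measurable_funM measurable_other_lorentz.
apply: measurable_funM.
  by do 2 apply: measurable_funM => //; exact: measurable_funM.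
apply: measurable_inv_nonneg => [t|]; first exact: sqr_ge0.
by apply: measurable_funX; apply: measurable_funD; exact: measurable_funX.
Qed.

Lemma prod_lorentz_growth (t : 'rV[R]_n) : (forall l, 0 < w l) ->
  \prod_l lorentz (w l) (t 0 l - x l)
  <= \prod_l (2 * (1 + w l ^+ 2) * (1 + x l ^+ 2)) * growth_weight t.
Proof.
move=> w0; rewrite /growth_weight -big_split/=.
by apply: ler_prod => l _; rewrite lorentz_ge0 lorentz_growth.
Qed.

End ProfileIntegral.

Lemma growth_weight_ge0 t : 0 <= growth_weight t.
Proof. by apply: prodr_ge0 => l _; rewrite invr_ge0 addr_ge0 ?sqr_ge0. Qed.

Lemma measurable_growth_weight :
  measurable_fun [set: T] (growth_weight : T -> R).
Proof.
apply: measurable_prod => l _; apply: measurable_inv_nonneg => [t|].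
  by rewrite addr_ge0 ?sqr_ge0.
apply: measurable_funD => //; apply: measurable_funX.
by apply: continuous_borel_measurable; exact: coord_continuous.
Qed.

Variable mu : {measure set T -> \bar R}.

Lemma integrable_growth_weight : growth_condition mu ->
  mu.-integrable [set: T] (EFin \o (growth_weight : T -> R)).
Proof.
move=> gmu; apply/integrableP; split.
  by apply/measurable_EFinP; exact: measurable_growth_weight.
move: gmu; rewrite /growth_condition; apply: le_lt_trans.
rewrite le_eqVlt; apply/orP; left; apply/eqP; apply: eq_integral => t _ /=.
by rewrite ger0_norm// growth_weight_ge0.
Qed.

Lemma integrable_le_growth (f : T -> R) (C : R) : growth_condition mu ->
  measurable_fun [set: T] f -> (forall t, `|f t| <= C * growth_weight t) ->
  mu.-integrable [set: T] (EFin \o f).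
Proof.
move=> gmu mf fC.
apply: (le_integrable measurableT (g := EFin \o (fun t : T => C * growth_weight t))) => //.
- exact/measurable_EFinP.
- move=> t _ /=; rewrite lee_fin; apply: le_trans (fC t) _; exact: ler_norm.
- have := integrableZl measurableT C (integrable_growth_weight gmu).
  exact: eq_integrable.
Qed.

Lemma integrable_profile j1 j2 w x : growth_condition mu -> j1 != j2 ->
  (forall l, 0 < w l) ->
  mu.-integrable [set: T] (EFin \o (fun t : T =>
    profile j1 j2 w (fun l => (t : 'rV[R]_n) 0 l - x l))).
Proof.
move=> gmu j12 w0.
apply: integrable_le_growth (measurable_profile _ _ _ _) _ => // t.
exact: le_trans (profile_le _ j12 w0) (prod_lorentz_growth _ _ w0).
Qed.

Lemma integrable_coprofile j1 j2 w x : growth_condition mu -> j1 != j2 ->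
  (forall l, 0 < w l) ->
  mu.-integrable [set: T] (EFin \o (fun t : T =>
    coprofile j1 j2 w (fun l => (t : 'rV[R]_n) 0 l - x l))).
Proof.
move=> gmu j12 w0.
apply: integrable_le_growth (measurable_coprofile _ _ _ _) _ => // t.
exact: le_trans (coprofile_le _ j12 w0) (prod_lorentz_growth _ _ w0).
Qed.

(** The Nevanlinna condition makes a nonzero complex multiple of the integral of
    [profile + i coprofile] vanish; since both parts are integrable, the
    constant can be divided out. *)
Lemma profile_integral0 (j1 j2 : 'I_n) w x : nevanlinna_measure mu ->
  (j1 < j2)%N -> (forall l, 0 < w l) ->
  \int[mu]_t profile j1 j2 w (fun l => (t : 'rV[R]_n) 0 l - x l) = 0.
Proof.
move=> [gmu nmu] lt12 w0.
have j12 : j1 != j2 by apply/eqP => e; move: lt12; rewrite e ltnn.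
have iU := integrable_profile x gmu j12 w0.
have iV := integrable_coprofile x gmu j12 w0.
have zP : poly_upper_half_plane (\row_l (x l +i* w l)%C).
  by move=> l; rewrite mxE /=; exact: w0.
move: (nmu _ _ _ zP lt12); rewrite /cintegral.
set U := fun t : T => profile j1 j2 w (fun l => (t : 'rV[R]_n) 0 l - x l) in iU *.
set V := fun t : T => coprofile j1 j2 w (fun l => (t : 'rV[R]_n) 0 l - x l) in iV *.
have kE (t : T) : nevanlinna_kernel (\row_l (x l +i* w l)%C) j1 j2 t
    = kernel_const j1 j2 w * (U t +i* V t)%C by exact: nevanlinna_kernelE.
move: (kernel_const j1 j2 w) (kernel_const_neq0 j1 j2 w0) kE => [k1 k2] k0 kE.
under [X in (X +i* _)%C = _]eq_Rintegral => t _ do rewrite kE/=.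
under [X in (_ +i* X)%C = _]eq_Rintegral => t _ do rewrite kE/=.
have iZ (f : T -> R) r : mu.-integrable [set: T] (EFin \o f) ->
    mu.-integrable [set: T] (EFin \o (fun t => r * f t)).
  by move=> /(integrableZl measurableT r); exact: eq_integrable.
rewrite RintegralB// ?RintegralD// ?RintegralZl//; try exact: iZ.
move=> /eqP; rewrite eq_complex /= => /andP[/eqP e1 /eqP e2].
(* multiply by the conjugate of the constant *)
have : (k1 ^+ 2 + k2 ^+ 2) * (\int[mu]_t U t) = 0.
  rewrite -[RHS](_ : k1 * 0 + k2 * 0 = 0).
    rewrite -{1}e1 -{1}e2; ring.
  by rewrite !mulr0 addr0.
move/eqP; rewrite mulf_eq0 => /orP[|/eqP//].
rewrite paddr_eq0 ?sqr_ge0// !sqrf_eq0 => kk.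
by move: k0; rewrite eq_complex /= kk.
Qed.

End Integral.

(** * Sums of Lorentz factors along an arithmetic progression *)

Section LorentzSums.
Variable R : realType.
Implicit Types (u v w t s d : R).

(** A bounded increasing function whose unit increments dominate 1 / (1 + v^2)
    up to a factor 4: an elementary substitute for the arctangent, used to
    telescope. *)
Definition sigmoid u : R := u / (1 + `|u|).

Lemma sigmoid_bound u : `|sigmoid u| <= 1.
Proof.
have h : 0 < 1 + `|u| by rewrite ltr_pwDl.
rewrite /sigmoid normrM normfV (ger0_norm (ltW h)) ler_pdivrMr// mul1r.
by rewrite lerDr.
Qed.

Lemma lorentz1_le_sigmoid v :
  (1 + v ^+ 2)^-1 <= 4 * (sigmoid (v + 1) - sigmoid v).
Proof.
have p1 : 0 < 1 + v ^+ 2 by rewrite ltr_pwDl ?sqr_ge0.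
rewrite /sigmoid -div1r ler_pdivrMr//.
have [v0|v0] := lerP 0 v.
  rewrite !ger0_norm ?addr_ge0//.
  rewrite (_ : _ - _ = 1 / ((1 + (v + 1)) * (1 + v))); last first.
    by field; rewrite !gt_eqF//; lra.
  rewrite mulrAC mulrA mulr1 ler_pdivlMr; last by rewrite mulr_gt0//; lra.
  by have := sqr_ge0 (v - 1); have := sqr_ge0 v; rewrite !expr2; lra.
rewrite (ltr0_norm v0).
have [v1|v1] := lerP 0 (v + 1).
  rewrite (ger0_norm v1).
  have h1 : (v + 1) / 2 <= (v + 1) / (1 + (v + 1)).
    rewrite ler_pdivrMr// mulrAC ler_pdivlMr; last by lra.
    by have := mulr_ge0 v1 (ltW (_ : 0 < - v)); rewrite oppr_gt0 => /(_ v0); lra.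
  have h2 : - v / 2 <= - (v / (1 - v)).
    rewrite -mulNr ler_pdivrMr// mulrAC ler_pdivlMr; last by lra.
    by have := mulr_ge0 v1 (ltW (_ : 0 < - v)); rewrite oppr_gt0 => /(_ v0); lra.
  by have := sqr_ge0 v; nra.
rewrite (ltr0_norm v1).
rewrite (_ : _ - _ = 1 / ((1 - (v + 1)) * (1 - v))); last first.
  by field; rewrite !gt_eqF//; lra.
rewrite mulrAC mulrA mulr1 ler_pdivlMr; last by rewrite mulr_gt0//; lra.
by have := sqr_ge0 (v + 1); have := sqr_ge0 v; rewrite !expr2; lra.
Qed.

(** The bound does not depend on the number of terms: after scaling by [w], each
    term is at most four times a unit increment of [sigmoid], and these telescope. *)
Lemma sum_lorentz_grid w u (K : nat) : 0 < w ->
  \sum_(k < K) lorentz w (u - k%:R * w) <= 8.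
Proof.
move=> w0; pose v := u / w.
have h k : lorentz w (u - k%:R * w)
    <= 4 * (sigmoid (v - k%:R + 1) - sigmoid (v - k%:R)).
  apply: le_trans (lorentz1_le_sigmoid _); rewrite /lorentz /v le_eqVlt.
  apply/orP; left; apply/eqP; field.
  by rewrite addrC !gt_eqF ?sqD_gt0.
apply: (@le_trans _ _ (\sum_(k < K)
    4 * (sigmoid (v - k%:R + 1) - sigmoid (v - k%:R)))).
  by apply: ler_sum => k _; exact: h.
rewrite -mulr_sumr.
have -> : \sum_(i < K) (sigmoid (v - i%:R + 1) - sigmoid (v - i%:R))
    = sigmoid (v + 1) - sigmoid (v + 1 - K%:R).
  elim: K => [|K ih]; first by rewrite big_ord0 subr0 subrr.
  rewrite big_ord_recr/= ih -natr1.
  rewrite (_ : v - K%:R + 1 = v + 1 - K%:R); last by ring.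
  by rewrite (_ : v + 1 - (K%:R + 1) = v - K%:R); ring.
have := sigmoid_bound (v + 1); have := sigmoid_bound (v + 1 - K%:R).
by rewrite !ler_norml => /andP[? ?] /andP[? ?]; lra.
Qed.

Lemma lorentz_le1 w s : lorentz w s <= 1.
Proof.
rewrite /lorentz; have [->|w0] := eqVneq w 0.
  by rewrite expr0n mul0r ler01.
rewrite ler_pdivrMr ?mul1r ?lerDr ?sqr_ge0//.
by rewrite ltr_wpDl ?sqr_ge0// exprn_even_gt0.
Qed.

Lemma lorentz_far w s d : 0 < d -> d <= `|s| -> lorentz w s <= w ^+ 2 / d ^+ 2.
Proof.
move=> d0 ds; rewrite /lorentz ler_wpM2l ?sqr_ge0// lef_pV2 ?posrE.
- rewrite (le_trans (_ : _ <= s ^+ 2)) ?lerDl ?sqr_ge0//.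
  by rewrite -(real_normK (num_real s)) !expr2 ler_pM// ltW.
- rewrite ltr_wpDr ?sqr_ge0// -(real_normK (num_real s)) exprn_gt0//.
  exact: lt_le_trans ds.
- by rewrite exprn_gt0.
Qed.

Lemma lorentz_near w s : 0 < w -> 0 <= s <= w -> 2^-1 <= lorentz w s.
Proof.
move=> w0 /andP[s0 sw]; rewrite /lorentz ler_pdivlMr ?sqD_gt0//.
have : s ^+ 2 <= w ^+ 2 by rewrite !expr2 ler_pM.
by lra.
Qed.

(** Multiplying by 1 + t^2 costs a factor 1 + s^2, up to a constant, with s the
    distance from [t] to the node; since s^2 times a Lorentz factor is at most
    w^2, the surplus is at most w^2 per node, which is harmless as there are
    O(1/w) nodes. *)
Lemma sum_lorentz_growth w t (M : R) (K : nat) : 0 < w <= 1 -> 0 <= M ->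
    K%:R * w <= 2 * M ->
  \sum_(k < K.+1) lorentz w (t - (k%:R * w - M))
  <= (2 * (1 + M ^+ 2) * (9 + 2 * M)) * (1 + t ^+ 2)^-1.
Proof.
move=> /andP[w0 w1] M0 KM.
have p1 u : 0 < 1 + u ^+ 2 by rewrite ltr_pwDl ?sqr_ge0.
rewrite ler_pdivlMr// mulr_suml.
have term (k : 'I_K.+1) : lorentz w (t - (k%:R * w - M)) * (1 + t ^+ 2)
    <= 2 * (1 + M ^+ 2) * (lorentz w (t + M - k%:R * w) + w ^+ 2).
  set x := k%:R * w - M.
  have kM : k%:R * w <= 2 * M.
    by apply: le_trans KM; rewrite ler_pM2r// ler_nat -ltnS.
  have xM : x ^+ 2 <= M ^+ 2.
    have k0 : 0 <= k%:R * w by rewrite mulr_ge0// ltW.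
    rewrite -(real_normK (num_real x)) !expr2 ler_pM//;
      by rewrite /x ler_norml; apply/andP; split; lra.
  rewrite (_ : t + M - k%:R * w = t - x); last by rewrite /x; ring.
  apply: (@le_trans _ _ (lorentz w (t - x) *
      (2 * (1 + M ^+ 2) * (1 + (t - x) ^+ 2)))).
    rewrite ler_wpM2l ?lorentz_ge0//; apply: (le_trans (growth_shift _ x)).
    by rewrite ler_pM2r// ler_pM2l//; lra.
  rewrite mulrCA ler_pM2l ?mulr_gt0//.
  rewrite mulrDr mulr1 lerD2l /lorentz mulrAC ler_pdivrMr ?sqD_gt0//.
  by rewrite ler_wpM2l ?sqr_ge0// lerDl sqr_ge0.
apply: (le_trans (ler_sum _ _)) => [k _|]; first exact: term.
rewrite -mulr_sumr ler_wpM2l ?mulr_ge0 ?(ltW (p1 M))//.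
rewrite big_split/= sumr_const card_ord.
have := sum_lorentz_grid (t + M) K.+1 w0.
have : w ^+ 2 *+ K.+1 <= 2 * M + 1.
  rewrite -[_ *+ _]mulr_natl -natr1 mulrDl mul1r lerD//.
    apply: le_trans KM; rewrite ler_wpM2l// expr2.
    by rewrite ler_piMr// ltW.
  by rewrite expr_le1// ltW.
by lra.
Qed.

End LorentzSums.

(** * Lower bounds for a profile *)

Section ProfileSign.
Variables (R : realType) (n : nat) (j1 j2 : 'I_n).
Implicit Types (w s : 'I_n -> R).

Lemma profile_ge0 w s : `|imX j1 j2 w s| <= reX j1 j2 w s ->
  0 <= profile j1 j2 w s.
Proof.
move=> h; rewrite mulr_ge0 ?prodr_ge0// => [|l _]; last exact: lorentz_ge0.
rewrite divr_ge0 ?sqr_ge0// mulr_ge0 ?sqr_ge0// subr_ge0.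
by rewrite -(real_normK (num_real (imX _ _ _ _))) !expr2 ler_pM.
Qed.

Definition profile_floor : R :=
  200^-1 * \prod_(l < n | (l != j1) && (l != j2)) 2^-1.

Lemma profile_floor_gt0 : 0 < profile_floor.
Proof. by rewrite mulr_gt0// prodr_gt0. Qed.

(** With X = [reX] and Y = [imX], the hypotheses give X^2 - Y^2 >= 5/16 r^2 and
    X^2 + Y^2 <= 13/2 r^2; the constant 1/200 is a round value below
    (5/16) / (13/2)^2. *)
Lemma profile_ge_floor w s (r : R) : 0 < r -> w j1 * w j2 = r ->
  3 / 4 * r <= reX j1 j2 w s <= 5 / 2 * r -> `|imX j1 j2 w s| <= r / 2 ->
  (forall l, l != j1 -> l != j2 -> 0 < w l /\ 0 <= s l <= w l) ->
  profile_floor <= profile j1 j2 w s.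
Proof.
move=> r0 wr /andP[X1 X2] Yr sw; rewrite /profile /profile_floor.
have X0 : 0 < reX j1 j2 w s by apply: lt_le_trans X1; rewrite mulr_gt0.
apply: ler_pM => //.
- by rewrite prodr_ge0.
- set X := reX _ _ _ _ in X1 X2 X0 *; set Y := imX _ _ _ _ in Yr *.
  have XX1 : (3 / 4 * r) ^+ 2 <= X ^+ 2.
    by rewrite !expr2 ler_pM// mulr_ge0// ltW.
  have XX2 : X ^+ 2 <= (5 / 2 * r) ^+ 2 by rewrite !expr2 ler_pM// ltW.
  have YY : Y ^+ 2 <= (r / 2) ^+ 2.
    by rewrite -(real_normK (num_real Y)) !expr2 ler_pM.
  rewrite wr ler_pdivlMr; last first.
    by rewrite exprn_gt0// ltr_wpDr ?sqr_ge0// exprn_gt0.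
  have XY : X ^+ 2 + Y ^+ 2 <= 13 / 2 * r ^+ 2.
    by move: XX2 YY; rewrite !expr2; lra.
  have XY2 : (X ^+ 2 + Y ^+ 2) ^+ 2 <= (13 / 2 * r ^+ 2) ^+ 2.
    rewrite [X in X <= _]expr2 [X in _ <= X]expr2 ler_pM//;
    by rewrite addr_ge0 ?sqr_ge0.
  have : r ^+ 2 * (5 / 16 * r ^+ 2) <= r ^+ 2 * (X ^+ 2 - Y ^+ 2).
    by rewrite ler_wpM2l ?sqr_ge0//; move: XX1 YY; rewrite !expr2; lra.
  have : 0 <= r ^+ 2 * r ^+ 2 by rewrite mulr_ge0 ?sqr_ge0.
  by move: XY2; lra.
- apply: ler_prod => l /andP[l1 l2]; rewrite invr_ge0 ler0n/=.
  by have [w0 ?] := sw l l1 l2; exact: lorentz_near.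
Qed.

End ProfileSign.

(** * The grid of centres on the hyperplane *)

Section Grid.
Variables (R : realType) (n : nat) (j1 j2 : 'I_n).
Hypothesis j12 : j1 != j2.
Variables (b : 'I_n -> R) (c : R) (M : nat).
Hypothesis b2 : 0 < b j2.
Implicit Types (t s : 'I_n -> R) (N : nat).

Definition others : pred 'I_n := fun l => (l != j1) && (l != j2).

(** The hyperplane is the zero set of [defect]. *)
Definition defect t : R := t j1 - \sum_(l | l != j1) b l * t l - c.

Definition rate (l : 'I_n) : nat := if others l then 3 else 1.

(** Direction [j1] gets [b j2] times the width of direction [j2], so that
    s_1 - i w_1 and s_2 - i w_2 are proportional on the hyperplane as soon as the
    other offsets vanish. *)
Definition width N (l : 'I_n) : R :=
  (if l == j1 then b j2 else 1) * N%:R^-1 ^+ rate l.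

(** Number of steps of length [width N l] across the interval from -M to M.
    Direction [j1] has the single index 0: its coordinate is determined by the
    others, see [grid_point]. *)
Definition grid_size N (l : 'I_n) : nat :=
  if l == j1 then 0 else (2 * M * N ^ rate l)%N.

(** One finite type of multi-indices for all directions; [in_grid] then cuts each
    direction down to its own number of nodes, so that sums over the grid
    distribute over products. *)
Definition grid_index N := {ffun 'I_n -> 'I_(2 * M * N ^ 3).+1}.

Definition in_grid N (f : grid_index N) : bool :=
  f \in family (fun l => [pred k : 'I_(2 * M * N ^ 3).+1 | (k < (grid_size N l).+1)%N]).

Definition node N (k : nat) (l : 'I_n) : R := k%:R * width N l - M%:R.

Definition grid_point N (f : grid_index N) (l : 'I_n) : R :=
  if l == j1 then \sum_(i | i != j1) b i * node N (f i) i + c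
  else node N (f l) l.

Definition offset N (f : grid_index N) t (l : 'I_n) : R := t l - grid_point f l.

Definition grid_sum N t : R :=
  \sum_(f : grid_index N | in_grid f) profile j1 j2 (width N) (offset f t).

(** An upper bound for the modulus of the profile centred at [f]. *)
Definition mass N (f : grid_index N) t : R :=
  \prod_l lorentz (width N l) (offset f t l).

Lemma width_gt0 N l : (0 < N)%N -> 0 < width N l.
Proof.
move=> N0; rewrite /width mulr_gt0//; first by case: ifP.
by rewrite exprn_gt0// invr_gt0 ltr0n.
Qed.

Lemma rate_gt0 l : (0 < rate l)%N.
Proof. by rewrite /rate; case: ifP. Qed.

Lemma invn_le1 N : (0 < N)%N -> (N%:R^-1 : R) <= 1.
Proof. by move=> N0; rewrite invf_le1 ?ltr0n// ler1n. Qed.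

Lemma width_le1 N l : (0 < N)%N -> l != j1 -> width N l <= 1.
Proof.
move=> N0 l1; rewrite /width (negbTE l1) mul1r.
by rewrite exprn_ile1 ?invn_le1.
Qed.

Lemma width_le N l : (0 < N)%N -> width N l <= (1 + b j2) * N%:R^-1.
Proof.
move=> N0; rewrite /width ler_pM ?exprn_ge0 ?invr_ge0//.
- by case: ifP => // _; rewrite ltW.
- by case: ifP => _; rewrite ?lerDr ?lerDl ltW.
- rewrite -[leRHS]expr1; apply: ler_wiXn2l; rewrite ?invr_ge0 ?invn_le1//.
  exact: rate_gt0.
Qed.

Lemma grid_size_widthE N l : (0 < N)%N -> l != j1 ->
  (grid_size N l)%:R * width N l = 2 * M%:R.
Proof.
move=> N0 /negbTE l1; rewrite /grid_size /width l1.
rewrite mul1r !natrM natrX exprVn -mulrA mulfV ?mulr1//.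
by rewrite expf_neq0// pnatr_eq0 -lt0n.
Qed.

Lemma grid_size_width N l : (0 < N)%N ->
  (grid_size N l)%:R * width N l <= 2 * M%:R.
Proof.
move=> N0; have [->|l1] := eqVneq l j1; last by rewrite grid_size_widthE.
by rewrite /grid_size eqxx mul0r mulr_ge0.
Qed.

Lemma grid_size_lt N l : (0 < N)%N ->
  ((grid_size N l).+1 <= (2 * M * N ^ 3).+1)%N.
Proof.
move=> N0; rewrite ltnS /grid_size; case: ifP => // _.
by rewrite leq_mul2l leq_pexp2l ?orbT// /rate; case: ifP.
Qed.

Lemma sum_grid_prod N (F : 'I_n -> nat -> R) : (0 < N)%N ->
  \sum_(f : grid_index N | in_grid f) \prod_l F l (f l)
  = \prod_l \sum_(k < (grid_size N l).+1) F l k.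
Proof.
move=> N0; rewrite [RHS](eq_bigr (fun l =>
  \sum_(k < (2 * M * N ^ 3).+1 | (k < (grid_size N l).+1)%N) F l k)); last first.
  by move=> l _; rewrite (big_ord_widen _ (F l) (grid_size_lt l N0)).
by rewrite bigA_distr_big_dep; apply: eq_bigl => f.
Qed.

Lemma node_bound N (f : grid_index N) l : (0 < N)%N -> in_grid f -> l != j1 ->
  `|node N (f l) l| <= M%:R.
Proof.
move=> N0 /familyP/(_ l); rewrite inE ltnS => fl l1.
have w0 := width_gt0 l N0.
have : (f l)%:R * width N l <= 2 * M%:R.
  by apply: le_trans (grid_size_width l N0); rewrite ler_pM2r// ler_nat.
have : 0 <= (f l)%:R * width N l by rewrite mulr_ge0// ltW.
by rewrite /node ler_norml => ? ?; apply/andP; split; lra.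
Qed.

Definition slope : R := \sum_(l | l != j1) `|b l|.

Lemma grid_point_j1_bound N (f : grid_index N) : (0 < N)%N -> in_grid f ->
  `|grid_point f j1| <= slope * M%:R + `|c|.
Proof.
move=> N0 fG; rewrite /grid_point eqxx.
apply: le_trans (ler_normD _ _) _; rewrite lerD2r.
apply: le_trans (ler_norm_sum _ _ _) _.
rewrite /slope mulr_suml; apply: ler_sum => l l1.
by rewrite normrM ler_wpM2l// node_bound.
Qed.

(** Centres lie on the hyperplane, so offsets satisfy its linear equation up to
    the defect of [t]. *)
Lemma defect_offset N (f : grid_index N) t :
  offset f t j1 - \sum_(l | l != j1) b l * offset f t l = defect t.
Proof.
rewrite /offset /defect /grid_point eqxx.
rewrite [X in _ - X = _](eq_bigr (fun l => b l * t l - b l * node N (f l) l)); last first.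
  by move=> l /negbTE l1; rewrite l1 mulrBr.
by rewrite sumrB; ring.
Qed.

Lemma mass_ge0 N (f : grid_index N) t : 0 <= mass f t.
Proof. by apply: prodr_ge0 => l _; exact: lorentz_ge0. Qed.

Lemma profile_le_mass N (f : grid_index N) t : (0 < N)%N ->
  `|profile j1 j2 (width N) (offset f t)| <= mass f t.
Proof. by move=> N0; apply: profile_le => // l; exact: width_gt0. Qed.

(** Direction [j1] uses only that the first coordinates of the centres are
    bounded; the others use the summation bound [sum_lorentz_growth]. *)
Definition growth_const : R :=
  \prod_(l < n) (if l == j1
     then 2 * (1 + b j2 ^+ 2) * (1 + (slope * M%:R + `|c|) ^+ 2)
     else 2 * (1 + M%:R ^+ 2) * (9 + 2 * M%:R)).

(** The factor in direction [j1] depends on all the indices; once it is replaced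
    by a bound uniform in the centre, the sum over the grid factors into sums
    over single directions. *)
Lemma grid_sum_growth N t : (0 < N)%N ->
  `|grid_sum N t| <= growth_const * \prod_l (1 + t l ^+ 2)^-1.
Proof.
move=> N0; apply: le_trans (ler_norm_sum _ _ _) _.
pose F (l : 'I_n) (k : nat) := if l == j1
     then 2 * (1 + b j2 ^+ 2) * (1 + (slope * M%:R + `|c|) ^+ 2)
          * (1 + t l ^+ 2)^-1
     else lorentz (width N l) (t l - node N k l).
have p1 (u : R) : 0 < 1 + u ^+ 2 by rewrite ltr_pwDl ?sqr_ge0.
apply: (@le_trans _ _ (\sum_(f : grid_index N | in_grid f) \prod_l F l (f l))).
  apply: ler_sum => f fG; apply: le_trans (profile_le_mass f t N0) _.
  apply: ler_prod => l _; rewrite lorentz_ge0/= /offset /F.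
  case: eqP => [->|/eqP/negbTE l1]; last by rewrite /grid_point l1.
  apply: le_trans (lorentz_growth _ _ (width_gt0 j1 N0)) _.
  rewrite ler_wpM2r ?invr_ge0 ?(ltW (p1 _))//.
  have w0 := width_gt0 j1 N0.
  have wb : width N j1 <= b j2.
    rewrite /width eqxx /rate /others eqxx expr1 ler_piMr ?(ltW b2)//.
    exact: invn_le1.
  have := grid_point_j1_bound N0 fG.
  set x := grid_point f j1 => xb.
  rewrite ler_pM ?mulr_ge0 ?(ltW (p1 _))//.
    by rewrite ler_pM2l// lerD2l !expr2 ler_pM// ltW.
  by rewrite lerD2l -(real_normK (num_real x)) !expr2 ler_pM.
rewrite sum_grid_prod// /growth_const -big_split/=.
apply: ler_prod => l _; apply/andP; split.
  apply: sumr_ge0 => k _; rewrite /F; case: ifP => _; last exact: lorentz_ge0.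
  by rewrite !mulr_ge0 ?invr_ge0 ?(ltW (p1 _)).
rewrite /F /grid_size; case: ifP => l1; first by rewrite big_ord1.
have := grid_size_width l N0; rewrite /grid_size l1 => KM.
by apply: sum_lorentz_growth; rewrite ?width_gt0 ?width_le1 ?l1.
Qed.

Definition count_bound : R := 2 * M%:R + (1 + b j2).

Lemma count_width N l : (0 < N)%N ->
  (grid_size N l).+1%:R * width N l <= count_bound.
Proof.
move=> N0; rewrite -natr1 mulrDl mul1r lerD ?grid_size_width//.
apply: le_trans (width_le l N0) _; rewrite ler_piMr ?invn_le1//.
by rewrite addr_ge0// ltW.
Qed.

(** In direction [l] every factor is at most w^2 / d^2 and there are O(1/w) nodes;
    in direction [j1] the factor is at most 1; every other direction sums to at
    most 8. *)
Lemma far_mass_coord N t l (d : R) : (0 < N)%N -> 0 < d ->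
  \sum_(f : grid_index N | in_grid f && (d <= `|offset f t l|)) mass f t
  <= count_bound * 8 ^+ n * (width N l / d ^+ 2).
Proof.
move=> N0 d0.
pose F (i : 'I_n) (k : nat) := if i == l then width N l ^+ 2 / d ^+ 2
  else if i == j1 then 1 else lorentz (width N i) (t i - node N k i).
have F0 i k : 0 <= F i k.
  rewrite /F; case: ifP => _; first by rewrite divr_ge0 ?sqr_ge0.
  by case: ifP => // _; exact: lorentz_ge0.
apply: (@le_trans _ _ (\sum_(f : grid_index N | in_grid f) \prod_l F l (f l))).
  rewrite big_mkcondr/=; apply: ler_sum => f fG; case: ifP => df; last first.
    by apply: prodr_ge0.
  apply: ler_prod => i _; rewrite lorentz_ge0/= /F.
  case: eqP => [->|_]; first exact: lorentz_far.
  case: eqP => [_|/eqP/negbTE i1]; first exact: lorentz_le1.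
  by rewrite /offset /grid_point i1.
rewrite sum_grid_prod// (bigD1 l)//=.
have w0 := width_gt0 l N0.
have -> : count_bound * 8 ^+ n * (width N l / d ^+ 2)
    = (count_bound * (width N l / d ^+ 2)) * 8 ^+ n by ring.
apply: ler_pM.
- by apply: sumr_ge0.
- by apply: prodr_ge0 => i _; apply: sumr_ge0.
- rewrite /F eqxx sumr_const card_ord -[_ *+ _]mulr_natl.
  rewrite [width N l ^+ 2]expr2 -[width N l * _ / _]mulrA.
  rewrite [leLHS]mulrA.
  by rewrite ler_wpM2r ?count_width// divr_ge0 ?sqr_ge0// ltW.
- apply: (@le_trans _ _ (\prod_(i < n | i != l) 8)).
    apply: ler_prod => i /negbTE il; rewrite sumr_ge0//= /F il.
    case: (boolP (i == j1)) => i1.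
      by rewrite /grid_size i1 big_ord1; lra.
    apply: le_trans (sum_lorentz_grid (t i + M%:R) (grid_size N i).+1
      (width_gt0 i N0)).
    apply: ler_sum => k _; rewrite le_eqVlt; apply/orP; left; apply/eqP.
    by congr lorentz; rewrite /node; ring.
  rewrite prodr_const; apply: ler_weXn2l => //; first by lra.
  by apply: leq_trans (max_card _) _; rewrite card_ord.
Qed.

Lemma far_mass N t (P : pred 'I_n) (d : R) : (0 < N)%N -> 0 < d ->
  \sum_(f : grid_index N | in_grid f && [exists l, P l && (d <= `|offset f t l|)])
    mass f t
  <= \sum_(l | P l) count_bound * 8 ^+ n * (width N l / d ^+ 2).
Proof.
move=> N0 d0.
apply: (@le_trans _ _ (\sum_(l | P l)
  \sum_(f : grid_index N | in_grid f && (d <= `|offset f t l|)) mass f t)); last first.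
  by apply: ler_sum => l _; exact: far_mass_coord.
under [leRHS]eq_bigr do rewrite big_mkcondr/=.
rewrite exchange_big/= big_mkcondr/=; apply: ler_sum => f fG.
have h l : 0 <= if d <= `|offset f t l| then mass f t else 0.
  by case: ifP => // _; exact: mass_ge0.
case: ifP => [/existsP[l /andP[Pl dl]]|_]; last exact: sumr_ge0.
by rewrite (bigD1 l)//= dl lerDl sumr_ge0.
Qed.

(** * Pointwise behaviour of the grid sums *)

Section Pointwise.
Variables (q : nat).
Hypothesis q0 : (0 < q)%N.
Hypothesis qb : slope * q%:R^-1 <= b j2 / 2.

(** On the hyperplane s_1 = b_2 s_2 + V with V at most half the width in
    direction [j1].  Then imX = V w_2, and reX differs from
    b_2 (s_2^2 + w_2^2) by V s_2, which is at most a quarter of it. *)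
Lemma near_profile N (f : grid_index N) t : (0 < N)%N -> defect t = 0 ->
  (forall l, others l -> `|offset f t l| <= N%:R^-1 * q%:R^-1) ->
  let r := width N j1 * width N j2 in
  [/\ `|imX j1 j2 (width N) (offset f t)| <= r / 2,
      3 / 4 * r <= reX j1 j2 (width N) (offset f t) &
      `|offset f t j2| <= width N j2 ->
        reX j1 j2 (width N) (offset f t) <= 5 / 2 * r].
Proof.
move=> N0 Dt near r.
have w1 : width N j1 = b j2 * N%:R^-1.
  by rewrite /width /rate /others eqxx expr1.
have w2 : width N j2 = N%:R^-1.
  by rewrite /width /rate /others eqxx andbF eq_sym (negbTE j12) mul1r expr1.
have y0 : 0 < (N%:R^-1 : R) by rewrite invr_gt0 ltr0n.
have := defect_offset f t; rewrite Dt (bigD1 j2) 1?eq_sym//=.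
set V := \sum_(_ | _) _ => s1.
have VB : `|V| <= b j2 / 2 * N%:R^-1.
  apply: le_trans (ler_norm_sum _ _ _) _.
  apply: (@le_trans _ _ (\sum_(l | l != j1) `|b l| * (N%:R^-1 * q%:R^-1))).
    rewrite [leRHS](bigID (fun l => l != j2))/=.
    rewrite -[leLHS]addr0 lerD//.
      apply: ler_sum => l lo; rewrite normrM ler_wpM2l//.
      exact: near.
    by apply: sumr_ge0 => l _; rewrite mulr_ge0// mulr_ge0 ?invr_ge0.
  rewrite -mulr_suml mulrCA mulrC -/slope.
  by rewrite ler_wpM2r ?invr_ge0.
rewrite /r /reX /imX {}w1 {}w2.
move: (N%:R^-1 : R) (offset f t j1) (offset f t j2) y0 s1 VB => y u v y0 uv VB.
have {uv}-> : u = b j2 * v + V by move: uv; lra.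
have Vv : `|V * v| <= b j2 / 4 * (v ^+ 2 + y ^+ 2).
  rewrite normrM.
  apply: (@le_trans _ _ (b j2 / 2 * y * `|v|)); first by rewrite ler_wpM2r.
  have := mulr_ge0 (ltW b2) (sqr_ge0 (`|v| - y)).
  rewrite sqrrB (real_normK (num_real v)).
  by lra.
split.
- rewrite (_ : _ - _ = V * y); last by ring.
  by rewrite normrM (gtr0_norm y0); have := ler_wpM2r (ltW y0) VB; lra.
- have := mulr_ge0 (ltW b2) (sqr_ge0 v).
  by move: Vv; rewrite ler_norml => /andP[? ?]; rewrite ?expr2; lra.
- move=> vy; have : v ^+ 2 <= y ^+ 2.
    by rewrite -(real_normK (num_real v)) !expr2 ler_pM.

  move/(ler_wpM2l (ltW b2)).
  by move: Vv; rewrite ler_norml => /andP[? ?]; rewrite ?expr2; lra.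
Qed.

Definition in_box t : Prop := forall l, l != j1 -> `|t l| <= M%:R.

Lemma exists_near_node N t : (0 < N)%N -> in_box t ->
  exists2 f : grid_index N, in_grid f &
    forall l, l != j1 -> 0 <= offset f t l <= width N l.
Proof.
move=> N0 tM.
pose k l := Num.truncn ((t l + M%:R) / width N l).
have kb l : l != j1 ->
    (k l <= grid_size N l)%N /\ 0 <= t l - node N (k l) l <= width N l.
  move=> l1; have w0 := width_gt0 l N0.
  have := tM l l1; rewrite ler_norml => /andP[t1 t2].
  have t0 : 0 <= (t l + M%:R) / width N l by rewrite divr_ge0 ?(ltW w0)//; lra.
  have := truncn_itv t0; rewrite -/(k l) => /andP[k1 k2].
  split.
    rewrite -(ler_nat R); apply: le_trans k1 _.
    by rewrite ler_pdivrMr// grid_size_widthE//; lra.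
  move: k1 k2; rewrite ler_pdivlMr// ltr_pdivrMr// -natr1 /node => k1 k2.
  by apply/andP; split; lra.
pose f : grid_index N := [ffun l => if l == j1 then ord0 else inord (k l)].
have fk l : l != j1 -> f l = k l :> nat.
  move=> l1; rewrite ffunE (negbTE l1) inordK//.
  by apply: leq_trans (grid_size_lt l N0); rewrite ltnS; case: (kb l l1).
exists f.
  apply/familyP => l; rewrite inE ltnS.
  have [->|l1] := eqVneq l j1; first by rewrite ffunE eqxx.
  by rewrite fk//; case: (kb l l1).
move=> l l1; rewrite /offset /grid_point (negbTE l1) fk//.
by case: (kb l l1).
Qed.

(** The cubic rate is chosen for this estimate: with w = 1/N^3 and d of order 1/N,
    w / d^2 is of order 1/N. *)
Lemma far_mass_small N t : (0 < N)%N ->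
  \sum_(f : grid_index N | in_grid f
     && [exists l, others l && (N%:R^-1 * q%:R^-1 <= `|offset f t l|)])
    mass f t
  <= (\sum_(l | others l) count_bound * 8 ^+ n * q%:R ^+ 2) * N%:R^-1.
Proof.
move=> N0; apply: le_trans (far_mass t others N0 _) _.
  by rewrite mulr_gt0// invr_gt0 ltr0n.
rewrite mulr_suml; apply: ler_sum => l lo; rewrite -[leRHS]mulrA.
rewrite le_eqVlt; apply/orP; left; apply/eqP; congr (_ * _).
have /andP[/negbTE l1 _] := lo.
rewrite /width l1 /rate lo mul1r; field.
by rewrite !pnatr_eq0 -!lt0n N0 q0.
Qed.

Lemma grid_sum_ge N t (far : pred (grid_index N)) : (0 < N)%N ->
  \sum_(f : grid_index N | in_grid f && ~~ far f)
     profile j1 j2 (width N) (offset f t)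
  - \sum_(f : grid_index N | in_grid f && far f) mass f t <= grid_sum N t.
Proof.
move=> N0; rewrite /grid_sum [leRHS](bigID far)/= [leRHS]addrC lerD2l -sumrN.
apply: ler_sum => f _.
by have := profile_le_mass f t N0; rewrite ler_norml => /andP[].
Qed.

(** Off the hyperplane every centre is at distance at least a multiple of
    [`|defect t|] in some direction, so the whole sum is far mass. *)
Lemma grid_sum_off_hyperplane t : defect t != 0 -> exists C, forall N,
  (0 < N)%N -> - (C * N%:R^-1) <= grid_sum N t.
Proof.
move=> D0; pose d := `|defect t| / (1 + slope).
have sl0 : 0 <= slope by apply: sumr_ge0.
have d0 : 0 < d by rewrite divr_gt0 ?normr_gt0//; lra.
exists (\sum_(l < n) count_bound * 8 ^+ n * ((1 + b j2) / d ^+ 2)) => N N0.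
pose far (f : grid_index N) := [exists l, predT l && (d <= `|offset f t l|)].
apply: le_trans (grid_sum_ge t far N0).
have allfar f : far f.
  apply: contraT; rewrite /far => /existsPn nfar.
  have lt l : `|offset f t l| < d by have := nfar l; rewrite /= -ltNge.
  suff : `|defect t| < d * (1 + slope) by rewrite /d divfK ?ltxx// gt_eqF//; lra.
  rewrite -(defect_offset f t) mulrDr mulr1.
  apply: le_lt_trans (ler_normB _ _) _; apply: ltr_leD => //.
  apply: le_trans (ler_norm_sum _ _ _) _.
  rewrite /slope mulr_sumr; apply: ler_sum => l _.
  by rewrite normrM mulrC ler_wpM2r// ltW.
have -> : \sum_(f : grid_index N | in_grid f && ~~ far f)
    profile j1 j2 (width N) (offset f t) = 0.
  by apply: big1 => f; rewrite allfar andbF.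
rewrite add0r.
rewrite lerN2; apply: le_trans (far_mass t predT N0 d0) _.
rewrite mulr_suml; apply: ler_sum => l _; rewrite -[leRHS]mulrA.
rewrite ler_wpM2l//.
  rewrite mulr_ge0 ?exprn_ge0// /count_bound; have := ltW b2.
  by have := ler0n R M; lra.
rewrite [leRHS]mulrAC ler_wpM2r ?invr_ge0 ?sqr_ge0//.
exact: width_le.
Qed.

(** Near centres contribute nonnegatively, far ones O(1/N); if [t] lies in the
    box, the centre just below [t] in each direction but [j1] contributes at
    least [profile_floor]. *)
Lemma grid_sum_on_hyperplane t : defect t = 0 -> exists C, forall N,
  (q < N)%N -> - (C * N%:R^-1) <= grid_sum N t /\
    (in_box t -> profile_floor R j1 j2 - C * N%:R^-1 <= grid_sum N t).
Proof.
move=> Dt; exists (\sum_(l | others l) count_bound * 8 ^+ n * q%:R ^+ 2).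
move=> N qN; have N0 : (0 < N)%N by apply: leq_trans qN.
pose far (f : grid_index N) :=
  [exists l, others l && (N%:R^-1 * q%:R^-1 <= `|offset f t l|)].
have near f : ~~ far f -> forall l, others l ->
    `|offset f t l| <= N%:R^-1 * q%:R^-1.
  by move=> /existsPn h l lo; have := h l; rewrite lo/= -ltNge => /ltW.
have w2pos : 0 <= width N j1 * width N j2 by rewrite mulr_ge0// ltW ?width_gt0.
have ge0 f : ~~ far f -> 0 <= profile j1 j2 (width N) (offset f t).
  move=> /near/(near_profile N0 Dt) [h1 h2 _]; apply: profile_ge0.
  by apply: le_trans h1 _; apply: le_trans h2; lra.
have h := grid_sum_ge t far N0; have hf := far_mass_small t N0.
split.
  apply: le_trans h; rewrite -[leLHS]add0r lerD//; last by rewrite lerN2.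
  by apply: sumr_ge0 => f /andP[_]; exact: ge0.
move=> /(exists_near_node N0)[f fG fs].
have y0 : 0 < (N%:R^-1 : R) by rewrite invr_gt0 ltr0n.
have nf : ~~ far f.
  apply/existsPn => l; apply/negP => /andP[lo].
  have /andP[l1 _] := lo; have /andP[s0 sw] := fs l l1.
  rewrite ger0_norm// => /le_trans/(_ sw).
  rewrite /width (negbTE l1) mul1r /rate lo exprS ler_pM2l// leNgt => /negP; apply.
  apply: (@le_lt_trans _ _ N%:R^-1).
    by rewrite expr2 ler_piMr ?(ltW y0) ?invn_le1.
  by rewrite ltf_pV2 ?posrE ?ltr0n// ltr_nat.
apply: le_trans h; rewrite lerD ?lerN2//.
rewrite (bigD1 f) ?fG//= -[leLHS]addr0 lerD//; last first.
  by apply: sumr_ge0 => g /andP[/andP[_ ng] _]; exact: ge0.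
have [h1 h2 h3] := near_profile N0 Dt (near f nf).
have /andP[s0 sw] : 0 <= offset f t j2 <= width N j2 by apply: fs; rewrite eq_sym.
apply: (profile_ge_floor (r := width N j1 * width N j2)) => //.
- by rewrite mulr_gt0 ?width_gt0.
- by rewrite h2 h3// ger0_norm.
- by move=> l l1 l2; split; [exact: width_gt0|exact: fs].
Qed.

End Pointwise.

End Grid.

(** * Passage to the limit *)

Lemma limn_einf_ge (R : realType) (u : nat -> R) (v C : R) :
  (forall m, v - C * m.+1%:R^-1 <= u m) ->
  (v%:E <= limn_einf (fun m => (u m)%:E))%E.
Proof.
move=> vu; pose l m := (v - `|C| * m.+1%:R^-1)%:E.
have lv : l m @[m --> \oo] --> v%:E.
  apply: cvg_EFin; first by near=> m.
  rewrite -[X in _ --> X](_ : v - `|C| * 0 = v); last by rewrite mulr0 subr0.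
  apply: cvgB; first exact: cvg_cst.
  by apply: cvgM; [exact: cvg_cst|exact: cvg_harmonic].
rewrite limn_einf_lim -(cvg_lim _ lv)//.
apply: lee_lim; [by apply/cvg_ex; exists v%:E|exact: is_cvg_einfs|].
near=> m; apply: le_ereal_inf_tmp => _ [k /= mk <-].
rewrite lee_fin; apply: le_trans (vu k); rewrite lerD2l lerN2.
apply: (@le_trans _ _ (`|C| * k.+1%:R^-1)).
  by rewrite ler_wpM2r ?invr_ge0// ler_norm.
by rewrite ler_wpM2l// lef_pV2 ?posrE ?ltr0n// ler_nat.
Unshelve. all: by end_near. Qed.

(** Fatou's lemma for [f m + g], which is nonnegative with integral that of [g]:
    its lower limit is at least e times the indicator of [A], plus [g], so
    e times the measure of [A] is at most 0. *)
Lemma vanishing_integrals_null (d : measure_display) (T : measurableType d)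
    (R : realType) (mu : {measure set T -> \bar R}) (A : set T)
    (f : nat -> T -> R) (g : T -> R) (e : R) :
  measurable A -> 0 < e -> mu.-integrable [set: T] (EFin \o g) ->
  (forall m, measurable_fun [set: T] (f m)) ->
  (forall m t, `|f m t| <= g t) ->
  (forall m, (\int[mu]_t (f m t)%:E = 0)%E) ->
  (forall t, exists C, forall m, e * \1_A t - C * m.+1%:R^-1 <= f m t) ->
  mu A = 0%E.
Proof.
move=> mA e0 ig mf fg f0 fA.
have mg : measurable_fun [set: T] g by case/integrableP: ig => /measurable_EFinP.
have g0 t : 0 <= g t by apply: le_trans (fg 0 t).
have ifm m : mu.-integrable [set: T] (EFin \o f m).
  apply: (le_integrable measurableT) ig; first exact/measurable_EFinP.
  by move=> t _ /=; rewrite lee_fin (ger0_norm (g0 t)).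
have fg0 m t : 0 <= f m t + g t.
  by have := fg m t; rewrite ler_norml => /andP[]; lra.
have mfg m : measurable_fun [set: T] (fun t => (f m t + g t)%:E).
  by apply/measurable_EFinP; exact: measurable_funD.
have fatou_fg : (\int[mu]_t limn_einf (fun m => (f m t + g t)%:E)
    <= \int[mu]_t (g t)%:E)%E.
  pose I := fun m => (\int[mu]_t (f m t + g t)%:E)%E.
  have Ig : I = fun=> (\int[mu]_t (g t)%:E)%E.
    apply/funext => m; have := integralD_EFin measurableT (ifm m) ig.
    by rewrite /= f0 add0e => <-.
  have <- : limn_einf I = (\int[mu]_t (g t)%:E)%E.
    by rewrite Ig (cvg_limn_einf_sup (cvg_cst _)).1.
  by apply: fatou => // m t _; rewrite lee_fin.
have lower t : ((e * \1_A t + g t)%:E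
    <= limn_einf (fun m => (f m t + g t)%:E))%E.
  have [C fC] := fA t; apply: (@limn_einf_ge _ _ _ C) => m.
  by rewrite addrAC lerD2r.
have mlim : measurable_fun [set: T]
    (fun t => limn_einf (fun m => (f m t + g t)%:E)).
  apply: measurableT_comp => //.
  apply: (@measurable_fun_limn_esup _ _ _ _ (fun m t => (- (f m t + g t)%:E)%E)).
  by move=> m; exact: measurableT_comp.
have eA0 t : 0 <= e * \1_A t by rewrite mulr_ge0 ?(ltW e0)// indicE ler0n.
have : ((e%:E * mu A) + \int[mu]_t (g t)%:E <= \int[mu]_t (g t)%:E)%E.
  apply: le_trans fatou_fg.
  have -> : mu A = (\int[mu]_t (\1_A t)%:E)%E.
    by rewrite integral_indic// setIT.
  rewrite -ge0_integralZl_EFin//; last first.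
  - exact: ltW.
  - by apply/measurable_EFinP; exact: measurable_indic.
  rewrite -ge0_integralD//; last 4 first.
  - by move=> t _; rewrite -EFinM lee_fin.
  - apply/measurable_EFinP; apply: measurable_funM => //; exact: measurable_indic.
  - by move=> t _; rewrite lee_fin.
  - exact/measurable_EFinP.
  apply: ge0_le_integral => //.
  - by move=> t _; rewrite -EFinM -EFinD lee_fin addr_ge0.
  - by apply/measurable_EFinP; apply: measurable_funD => //;
    apply: measurable_funM => //; exact: measurable_indic.
  - by move=> t _; apply: le_trans (lower t); rewrite lee_fin.
have gfin : (\int[mu]_t (g t)%:E)%E \is a fin_num by exact: integrable_fin_num.
rewrite addeC -{2}[(\int[mu]_t (g t)%:E)%E]adde0 leeD2lE// => h.
apply/eqP; rewrite eq_le measure_ge0 andbT.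
by rewrite -(@pmule_rle0 _ e%:E)// lte_fin.
Qed.

(** * Null sets of Nevanlinna measures *)

Section Hyperplane.
Variables (R : realType) (n : nat) (mu : {measure set (borel_rV R n) -> \bar R}).
Hypothesis nmu : nevanlinna_measure mu.
Variables (j1 j2 : 'I_n) (b : 'I_n -> R) (c : R).
Hypothesis lt12 : (j1 < j2)%N.
Hypothesis b2 : 0 < b j2.
Local Notation T := (borel_rV R n).
Local Notation coords t := (fun l => (t : 'rV[R]_n) 0 l).

Let j12 : j1 != j2. Proof. by apply/eqP => e; move: lt12; rewrite e ltnn. Qed.

Lemma measurable_coord l : measurable_fun [set: T] (fun t : T => (t : 'rV[R]_n) 0 l).
Proof. by apply: continuous_borel_measurable; exact: coord_continuous. Qed.

Lemma measurable_defect :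
  measurable_fun [set: T] (fun t : T => defect j1 b c (coords t)).
Proof.
apply: measurable_funB => //; apply: measurable_funB.
  exact: measurable_coord.
have -> : (fun t : T => \sum_(l | l != j1) b l * (t : 'rV[R]_n) 0 l)
   = fun t : T => \sum_l (if l != j1 then b l else 0) * (t : 'rV[R]_n) 0 l.
  apply/funext => t; rewrite big_mkcond/=; apply: eq_bigr => l _.
  by case: ifP; rewrite ?mul0r.
apply: measurable_sum => l; apply: measurable_funM => //.
exact: measurable_coord.
Qed.

(** The part of the hyperplane covered by a grid of size [M]. *)
Definition slab (M : nat) : set T :=
  [set t : T | defect j1 b c (coords t) = 0 /\ in_box j1 M (coords t)].

Lemma measurable_slab M : measurable (slab M).
Proof.
have -> : slab M =
    (fun t : T => defect j1 b c (coords t)) @^-1` [set 0]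
    `&` \bigcap_(l in [set l | l != j1])
      ((fun t : T => `|(t : 'rV[R]_n) 0 l|) @^-1` `]-oo, M%:R]).
  apply/seteqP; split => t /= [tD tM]; split => // l l1; have := tM l l1;
  by rewrite /= in_itv.
apply: measurableI.
  by rewrite -[X in measurable X]setTI; exact: measurable_defect.
apply: fin_bigcap_measurable => [|l _]; first exact: finite_finset.
rewrite -[X in measurable X]setTI.
by apply: (measurableT_comp _ (measurable_coord l)).
Qed.

Lemma grid_sum_integral M N : (0 < N)%N ->
  (\int[mu]_(t in [set: T]) (grid_sum j1 j2 b c M N (coords t))%:E = 0)%E.
Proof.
move=> N0; have w0 l := width_gt0 j1 b2 l N0.
have ip (f : grid_index n M N) := integrable_profile (grid_point j1 j2 b c f)
  nmu.1 j12 w0.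
under eq_integral => t _ do rewrite /grid_sum -sumEFin.
rewrite integral_sum//; apply: big1 => f _.
have fin := integrable_fin_num measurableT (ip f).
have := profile_integral0 (grid_point j1 j2 b c f) nmu lt12 w0.
rewrite /Rintegral => i0; rewrite -[0%E]/((0 : R)%:E) -i0 fineK//.
Qed.

Lemma measurable_grid_sum M N :
  measurable_fun [set: T] (fun t : T => grid_sum j1 j2 b c M N (coords t)).
Proof.
have -> : (fun t : T => grid_sum j1 j2 b c M N (coords t))
   = fun t : T => \sum_(f : grid_index n M N) (if in_grid j1 j2 f then 1 else 0)
       * profile j1 j2 (width j1 j2 b N) (offset j1 j2 b c f (coords t)).
  apply/funext => t; rewrite /grid_sum big_mkcond/=; apply: eq_bigr => f _.
  by case: ifP; rewrite ?mul0r ?mul1r.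
apply: measurable_sum => f; apply: measurable_funM => //.
exact: measurable_profile.
Qed.

Lemma slab_null M : mu (slab M) = 0%E.
Proof.
have [q q0 qb] : exists2 q, (0 < q)%N & slope j1 b * q%:R^-1 <= b j2 / 2.
  exists (Num.truncn (slope j1 b * 2 / b j2)).+1 => //.
  rewrite ler_pdivrMr ?ltr0n// mulrAC ler_pdivlMr// mulrC.
  rewrite [leRHS]mulrC -ler_pdivrMr// mulrC.
  exact/ltW/truncnS_gt.
apply: (@vanishing_integrals_null _ _ _ _ _
  (fun m (t : T) => grid_sum j1 j2 b c M (m + q).+1 (coords t))
  (fun t : T => growth_const j1 j2 b c M * growth_weight t)
  (profile_floor R j1 j2)).
- exact: measurable_slab.
- exact: profile_floor_gt0.
- apply: eq_integrable (integrableZl measurableT _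
    (integrable_growth_weight nmu.1)) => //.
- by move=> m; exact: measurable_grid_sum.
- by move=> m t; exact: grid_sum_growth.
- by move=> m; exact: grid_sum_integral.
- move=> t.
  have rescale (C : R) m : C * (m + q).+1%:R^-1 <= `|C| * m.+1%:R^-1.
    apply: (@le_trans _ _ (`|C| * (m + q).+1%:R^-1)).
      by rewrite ler_wpM2r ?invr_ge0// ler_norm.
    by rewrite ler_wpM2l// lef_pV2 ?posrE ?ltr0n// ler_nat ltnS leq_addr.
  have [D0|D0] := eqVneq (defect j1 b c (coords t)) 0; last first.
    have [C hC] := grid_sum_off_hyperplane j12 M b2 D0.
    exists `|C| => m; apply: le_trans (hC (m + q).+1 isT).
    rewrite indicE memNset ?mulr0 ?sub0r ?lerN2//.
    by move=> [] /eqP; rewrite (negbTE D0).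
  have [C hC] := grid_sum_on_hyperplane j12 M b2 q0 qb D0.
  exists `|C| => m; have [|h1 h2] := hC (m + q).+1; first by rewrite ltnS leq_addl.
  rewrite indicE; case: (boolP (t \in slab M)) => [/set_mem[_ /h2]|_].
    by rewrite mulr1; apply: le_trans; rewrite lerD2l lerN2.
  by rewrite mulr0 sub0r; apply: le_trans h1; rewrite lerN2.
Qed.

Lemma graph_null : mu [set t : T | defect j1 b c (coords t) = 0] = 0%E.
Proof.
have mD : measurable [set t : T | defect j1 b c (coords t) = 0].
  rewrite -[X in measurable X]setTI.
  exact: (measurable_defect measurableT (measurable_set1 0)).
apply/negligibleP => //.
rewrite (_ : [set t : T | _] = \bigcup_M slab M).
  apply: negligible_bigcup => M; apply/negligibleP; first exact: measurable_slab.
  exact: slab_null.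
apply/seteqP; split => [t /= tD|t [M _ []]//].
exists (Num.truncn (\sum_l `|(t : 'rV[R]_n) 0 l|)).+1 => //; split => // l _.
apply: ltW; apply: le_lt_trans (truncnS_gt _).
by rewrite (bigD1 l)//= lerDl sumr_ge0.
Qed.

End Hyperplane.

(** A normal outside both closed orthants has a positive and a negative entry;
    dividing the equation by one of them gives the graph form with a positive
    slope in the other direction. *)
Theorem theorem3p13 (R : realType) (n : nat) (L : set 'rV[R]_n)
    (a : 'rV[R]_n)
    (La : is_hyperplane_with_normal L a)
    (aN : ~ (nonpos_orthant R n `|` nonneg_orthant R n) a)
    (mu : {measure set (borel_rV R n) -> \bar R}) :
  nevanlinna_measure mu -> mu L = 0%E.
Proof.
move=> nmu; have [_ [c ->]] := La.
have opp : exists j1 j2 : 'I_n, (j1 < j2)%N /\ a 0 j1 * a 0 j2 < 0.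
  have [i ai] : exists i, 0 < a 0 i.
    apply: contrapT => h; apply: aN; left => i; rewrite leNgt; apply/negP => ai.
    by apply: h; exists i.
  have [j aj] : exists j, a 0 j < 0.
    apply: contrapT => h; apply: aN; right => j; rewrite leNgt; apply/negP => aj.
    by apply: h; exists j.
  have ij : a 0 i * a 0 j < 0 by rewrite pmulr_rlt0.
  case: (ltngtP i j) => [lt|lt|/val_inj e]; first by exists i, j.
    by exists j, i; rewrite mulrC.
  by move: ai; rewrite e => /lt_trans/(_ aj); rewrite ltxx.
have [j1 [j2 [lt12 a12]]] := opp.
have a1 : a 0 j1 != 0 by apply/eqP => e; move: a12; rewrite e mul0r ltxx.
pose b l := - (a 0 l / a 0 j1).
have b2 : 0 < b j2.
  have -> : b j2 = - (a 0 j1 * a 0 j2) / a 0 j1 ^+ 2 by rewrite /b; field.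
  by rewrite divr_gt0 ?oppr_gt0// exprn_even_gt0.
rewrite -(graph_null nmu (c / a 0 j1) lt12 b2); congr (mu _).
apply/funext => x /=; apply/propext.
have -> : defect j1 b (c / a 0 j1) (fun l => x 0 l)
    = (\sum_i a 0 i * x 0 i - c) / a 0 j1.
  rewrite /defect [in RHS](bigD1 j1)//= !mulrDl mulrAC mulfV// mul1r mulr_suml mulNr.
  congr (_ + _ - _); rewrite -sumrN; apply: eq_bigr => l _.
  by rewrite /b mulNr opprK mulrAC.
split => [->|/eqP]; first by rewrite subrr mul0r.
by rewrite mulf_eq0 invr_eq0 (negbTE a1) orbF subr_eq0 => /eqP.
Qed.
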